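(* Let $f_1,\dots,f_n:\mathbb{R}^d\to\mathbb{R}$ be twice differentiable (not necessarily convex) and $L$-smooth, with Hessians $H_i$ satisfying $\|H_i(x)-H_i(y)\|\le L_H\|x-y\|$ for all $x,y$. Suppose $F=\frac1n\sum_{i=1}^nf_i$ has minimum value $F^*$ and satisfies the Polyak-\L{}ojasiewicz condition with constant $\mu>0$: $$\tfrac12\|\nabla F(x)\|^2\ge\mu\,(F(x)-F^* )\qquad\text{for all }x\in\mathbb{R}^d.$$ Put $\kappa=L/\mu$ and assume the boundedness assumptions with constants $D,G$ stated in the context. Let $T\ge2$ be a multiple of $n$ with $\frac{T}{\log T}>16\kappa^2n$, and run RandomShuffle on $F$ for $T$ iterations with constant step size $\frac{2\log T}{T\mu}$. Then $$\mathbb{E}\big[F(x_T)-F^*\big]\le\mathcal{O}\Big(\frac1{T^2}+\frac{n^3}{T^3}\Big).$$ That is, there are constants $C_0,q>0$ depending only on $\mu,L,L_H,D,G$ such that the left side is at most $C_0(1+\log T)^q\big(\frac1{T^2}+\frac{n^3}{T^3}\big)$.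
   Context: Norms are Euclidean for vectors and spectral for matrices. $f$ is $L$-smooth if $\|\nabla f(x)-\nabla f(y)\|\le L\|x-y\|$ for all $x,y$. RandomShuffle with step size $\gamma$, run for $T=ln$ iterations ($l$ a positive integer, the number of epochs) from $x_0\in\mathbb{R}^d$: set $x^1_0=x_0$. In each epoch $t=1,\dots,l$ draw a permutation $\sigma_t$ of $\{1,\dots,n\}$ uniformly at random, independently across epochs, and for $k=1,\dots,n$ set $x^t_k=x^t_{k-1}-\gamma\nabla f_{\sigma_t(k)}(x^t_{k-1})$; then put $x^{t+1}_0=x^t_n$. The output is $x_T=x^l_n$. Expectation is over the permutations. Boundedness assumptions: there are a minimizer $x^*$ of $F$ and constants $D,G>0$ such that, for every realization of the permutations, every iterate $x$ satisfies $\|x-x^*\|\le D$; and $\|\nabla f_i(x)\|\le G$ for all $i$ and all $x$ with $\|x-x^*\|\le D$. Convention: $\mathcal{O}(\cdot)$ hides logarithmic factors and constants depending only on the problem constants, not on $n$ or $T$. *)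

(* Defs.v *)
From HB Require Import structures.
From mathcomp Require Import all_boot all_order all_algebra all_fingroup.
From mathcomp Require Import all_classical all_reals all_analysis.

Set Implicit Arguments.
Unset Strict Implicit.
Unset Printing Implicit Defensive.

Import Order.TTheory GRing.Theory Num.Theory.
Import numFieldNormedType.Exports.

Local Open Scope classical_set_scope.
Local Open Scope ring_scope.

(* The library norm `|v| on 'rV[R]_d is the sup norm, hence this definition.
   The two norms are equivalent, so [differentiable], which is stated with the
   library norm, is the usual notion on Euclidean space. *)
Definition enorm (R : realType) (d : nat) (v : 'rV[R]_d) : R :=
  Num.sqrt (\sum_(j < d) v 0 j ^+ 2).

(* Operator norm for Euclidean norms. Matrices act on row vectors on the right,
   which is the convention of the library's Jacobian; A and A^T have the same
   spectral norm. *)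
Definition specnorm (R : realType) (m n : nat) (A : 'M[R]_(m, n)) : R :=
  sup [set enorm (v *m A) | v in [set v : 'rV[R]_m | enorm v <= 1]].

Definition grad (R : realType) (d : nat) (f : 'rV[R]_d -> R) (x : 'rV[R]_d) :
    'rV[R]_d :=
  \row_(j < d) 'D_(delta_mx 0 j) f x.

Definition hess (R : realType) (d : nat) (f : 'rV[R]_d -> R) (x : 'rV[R]_d) :
    'M[R]_d :=
  'J (grad f) x.

Definition twice_differentiable (R : realType) (d : nat)
    (f : 'rV[R]_d -> R) : Prop :=
  (forall x, differentiable f x) /\ (forall x, differentiable (grad f) x).

Definition smooth (R : realType) (d : nat) (L : R) (f : 'rV[R]_d -> R) : Prop :=
  forall x y, enorm (grad f x - grad f y) <= L * enorm (x - y).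

Definition lipschitz_hessian (R : realType) (d : nat) (LH : R)
    (f : 'rV[R]_d -> R) : Prop :=
  forall x y, specnorm (hess f x - hess f y) <= LH * enorm (x - y).

Definition average (R : realType) (d n : nat) (f : 'I_n -> 'rV[R]_d -> R)
    (x : 'rV[R]_d) : R :=
  n%:R^-1 * \sum_(i < n) f i x.

Definition is_min_value (R : realType) (d : nat) (F : 'rV[R]_d -> R)
    (Fstar : R) : Prop :=
  (forall x, Fstar <= F x) /\ (exists x, F x = Fstar).

Definition is_minimizer (R : realType) (d : nat) (F : 'rV[R]_d -> R)
    (xstar : 'rV[R]_d) : Prop :=
  forall x, F xstar <= F x.

Definition polyak_lojasiewicz (R : realType) (d : nat) (mu : R)
    (F : 'rV[R]_d -> R) (Fstar : R) : Prop :=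
  forall x, mu * (F x - Fstar) <= 2^-1 * enorm (grad F x) ^+ 2.

(* [enum 'I_n] lists 0, ..., n - 1 in increasing order, so this is the point
   reached after the first k steps of an epoch started at x with permutation
   s. *)
Definition epoch_iter (R : realType) (d n : nat) (f : 'I_n -> 'rV[R]_d -> R)
    (gamma : R) (s : 'S_n) (x : 'rV[R]_d) (k : nat) : 'rV[R]_d :=
  foldl (fun y i => y - gamma *: grad (f (s i)) y) x (take k (enum 'I_n)).

(* The point reached after t complete epochs; it is the starting point of the
   epoch whose permutation is [sigma t], epochs being numbered from 0. *)
Definition epoch_start (R : realType) (d n l : nat)
    (f : 'I_n -> 'rV[R]_d -> R) (gamma : R) (sigma : {ffun 'I_l -> 'S_n})
    (x0 : 'rV[R]_d) (t : nat) : 'rV[R]_d :=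
  foldl (fun y u => epoch_iter f gamma (sigma u) y n) x0 (take t (enum 'I_l)).

Definition shuffle_iter (R : realType) (d n l : nat)
    (f : 'I_n -> 'rV[R]_d -> R) (gamma : R) (sigma : {ffun 'I_l -> 'S_n})
    (x0 : 'rV[R]_d) (t : 'I_l) (k : nat) : 'rV[R]_d :=
  epoch_iter f gamma (sigma t) (epoch_start f gamma sigma x0 t) k.

Definition shuffle_output (R : realType) (d n l : nat)
    (f : 'I_n -> 'rV[R]_d -> R) (gamma : R) (sigma : {ffun 'I_l -> 'S_n})
    (x0 : 'rV[R]_d) : 'rV[R]_d :=
  epoch_start f gamma sigma x0 l.

(* Independent uniform permutations, one per epoch, are a uniform element of the
   finite set {ffun 'I_l -> 'S_n}; the expectation is the average over it. *)
Definition shuffle_expectation (R : realType) (n l : nat)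
    (X : {ffun 'I_l -> 'S_n} -> R) : R :=
  (\sum_(sigma : {ffun 'I_l -> 'S_n}) X sigma) / #|{ffun 'I_l -> 'S_n}|%:R.

Definition bounded_run (R : realType) (d n : nat) (l : nat)
    (f : 'I_n -> 'rV[R]_d -> R) (gamma : R) (x0 : 'rV[R]_d)
    (D G : R) : Prop :=
  exists xstar : 'rV[R]_d,
    [/\ is_minimizer (average f) xstar,
        forall (sigma : {ffun 'I_l -> 'S_n}) (t : 'I_l) (k : nat),
          (k <= n)%N -> enorm (shuffle_iter f gamma sigma x0 t k - xstar) <= D
      & forall (i : 'I_n) (x : 'rV[R]_d),
          enorm (x - xstar) <= D -> enorm (grad (f i) x) <= G].

(* Main.v *)
Require Import Defs.
From HB Require Import structures.
From mathcomp Require Import all_boot all_order all_algebra all_fingroup.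
From mathcomp Require Import all_classical all_reals all_analysis.
From mathcomp Require Import ring lra zify.
Import Order.TTheory GRing.Theory Num.Theory.
Import numFieldNormedType.Exports.
Local Open Scope ring_scope.

Set Implicit Arguments.
Unset Strict Implicit.
Unset Printing Implicit Defensive.

(** Write N for gamma n, the total step of an epoch, and g for the gradient of F at
    the start x of the epoch. An epoch is one gradient step of length N perturbed by
    the fact that the k-th component gradient is evaluated at a moved point. To
    second order the k-th perturbation is the Hessian of the k-th component applied
    to the displacement - gamma (sum of the earlier component gradients at x), so its
    effect on F is gamma^2 times the sum, over the pairs j < k of steps, of
    <(grad f_j) H_k, g>.

    Averaging over the permutation is what makes this small. A permutation and its
    reversal are equally likely, so the mean over the pairs j < k is half of the sum
    over all pairs of distinct indices ([sum_perm_ordered_pairs]). The full double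
    sum is quadratic in g, because the component gradients add up to n g, and is
    absorbed by the decrease N |g|^2; only the diagonal remains, which has n terms
    instead of n^2 ([sum_interaction_le]). Every other error is of order N^2 |g|^2,
    N^3 |g| or N^4. Since N L <= 1/8, which is what the hypothesis on T gives, half of the
    decrease absorbs everything that depends on g, and the Polyak-Lojasiewicz
    inequality turns the other half into a contraction ([epoch_contraction]):
      E F(x') - F* <= (1 - N mu) (F(x) - F* ) + N O(gamma^2 + N^3).

    The epochs are independent, so this may be iterated, by resampling the
    permutation of a single epoch ([shuffle_expectation_resample]). After l epochs
    the initial gap has been multiplied by at most exp(- N mu l) = T^-2, and the
    errors sum up to O(gamma^2 + N^3) / mu, that is O(1/T^2 + n^3/T^3) up to
    powers of log T ([expected_gap_le]).

    The argument needs mu <= L. In the opposite case a smooth function can satisfy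
    the Polyak-Lojasiewicz inequality only if it is constant
    ([pl_smooth_constant]). *)

(** * Euclidean geometry *)

Section Euclidean.
Context {R : realType} {d : nat}.
Implicit Types u v w : 'rV[R]_d.

Definition dot u v : R := \sum_(j < d) u 0 j * v 0 j.

Lemma dotC u v : dot u v = dot v u.
Proof. by apply: eq_bigr => j _; rewrite mulrC. Qed.

Lemma dotDl u v w : dot (u + v) w = dot u w + dot v w.
Proof. by rewrite -big_split; apply: eq_bigr => j _; rewrite mxE mulrDl. Qed.

Lemma dotZl (a : R) u w : dot (a *: u) w = a * dot u w.
Proof. by rewrite mulr_sumr; apply: eq_bigr => j _; rewrite mxE mulrA. Qed.

Lemma dotNl u w : dot (- u) w = - dot u w.
Proof. by rewrite -scaleN1r dotZl mulN1r. Qed.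

Lemma dotBl u v w : dot (u - v) w = dot u w - dot v w.
Proof. by rewrite dotDl dotNl. Qed.

Lemma dot0l w : dot 0 w = 0.
Proof. by rewrite -(scale0r (0 : 'rV[R]_d)) dotZl mul0r. Qed.

Lemma dot_suml (I : Type) (r : seq I) (P : pred I) (u : I -> 'rV[R]_d) w :
  dot (\sum_(i <- r | P i) u i) w = \sum_(i <- r | P i) dot (u i) w.
Proof. by apply: (big_morph (dot^~ w)) => [x y|]; rewrite ?dotDl ?dot0l. Qed.

Lemma dotDr u v w : dot w (u + v) = dot w u + dot w v.
Proof. by rewrite !(dotC w) dotDl. Qed.

Lemma dotZr (a : R) u w : dot w (a *: u) = a * dot w u.
Proof. by rewrite !(dotC w) dotZl. Qed.

Lemma dotNr u w : dot w (- u) = - dot w u.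
Proof. by rewrite !(dotC w) dotNl. Qed.

Lemma dotvv_ge0 u : 0 <= dot u u.
Proof. by apply: sumr_ge0 => j _; rewrite -expr2 sqr_ge0. Qed.

Lemma enorm_ge0 u : 0 <= enorm u.
Proof. exact: sqrtr_ge0. Qed.

Lemma enorm_sqr u : enorm u ^+ 2 = dot u u.
Proof.
rewrite sqr_sqrtr; first by apply: eq_bigr => j _; rewrite expr2.
by apply: sumr_ge0 => j _; rewrite sqr_ge0.
Qed.

Lemma enorm_le u (c : R) : 0 <= c -> dot u u <= c ^+ 2 -> enorm u <= c.
Proof. by move=> c0; rewrite -enorm_sqr ler_pXn2r // nnegrE enorm_ge0. Qed.

Lemma enorm_eq0 u : enorm u = 0 -> u = 0.
Proof.
move=> u0; have: dot u u = 0 by rewrite -enorm_sqr u0 expr0n.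
move=> /psumr_eq0P uj0; apply/rowP => j; rewrite mxE.
apply/eqP; have /eqP := uj0 (fun j _ => sqr_ge0 (u 0 j)) j isT.
by rewrite mulf_eq0 orbb.
Qed.

(** Expanding the square of [enorm v *: u - enorm u *: v] leaves the defect
    [enorm u * enorm v - dot u v] with a nonnegative factor, so no sign
    discussion or discriminant is needed. *)
Lemma dot_le u v : dot u v <= enorm u * enorm v.
Proof.
have [/enorm_eq0 ->|u0] := eqVneq (enorm u) 0.
  by rewrite dot0l mulr_ge0 ?enorm_ge0.
have [/enorm_eq0 ->|v0] := eqVneq (enorm v) 0.
  by rewrite dotC dot0l mulr_ge0 ?enorm_ge0.
have ab : 0 < enorm u * enorm v by rewrite mulr_gt0 // lt0r ?u0 ?v0 enorm_ge0.
have := dotvv_ge0 (enorm v *: u - enorm u *: v).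
rewrite dotBl !(dotDr, dotNr, dotZl, dotZr) (dotC v u) -!enorm_sqr => h.
rewrite -(ler_pM2l ab); lra.
Qed.

Lemma enormN u : enorm (- u) = enorm u.
Proof. by rewrite /enorm; under eq_bigr do rewrite mxE sqrrN. Qed.

Lemma norm_dot_le u v : `|dot u v| <= enorm u * enorm v.
Proof.
by rewrite ler_norml dot_le andbT lerNl -dotNl -(enormN u) dot_le.
Qed.

Lemma enormD u v : enorm (u + v) <= enorm u + enorm v.
Proof.
apply: enorm_le; first by rewrite addr_ge0 ?enorm_ge0.
rewrite dotDl !dotDr (dotC v u) -!enorm_sqr.
have := dot_le u v; lra.
Qed.

Lemma enormZ (a : R) u : enorm (a *: u) = `|a| * enorm u.
Proof.
rewrite /enorm -sqrtr_sqr -sqrtrM ?sqr_ge0 // mulr_sumr.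
by congr Num.sqrt; apply: eq_bigr => j _; rewrite mxE exprMn.
Qed.

Lemma enorm0 : enorm (0 : 'rV[R]_d) = 0.
Proof. by rewrite -(scale0r 0) enormZ normr0 mul0r. Qed.

Lemma enorm_sum (I : Type) (r : seq I) (P : pred I) (u : I -> 'rV[R]_d) :
  enorm (\sum_(i <- r | P i) u i) <= \sum_(i <- r | P i) enorm (u i).
Proof.
elim/big_rec2: _ => [|i y1 y2 _ IH]; first by rewrite enorm0.
by rewrite (le_trans (enormD _ _)) // lerD2l.
Qed.

Lemma enorm_sum_le (I : finType) (P : pred I) (u : I -> 'rV[R]_d) (c : R) :
  (forall i, P i -> enorm (u i) <= c) ->
  enorm (\sum_(i | P i) u i) <= #|P|%:R * c.
Proof.
move=> uc; rewrite (le_trans (enorm_sum _ _ _)) // mulr_natl -sumr_const.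
exact: ler_sum.
Qed.

(** [#|P|] is replaced by [n] because only the order of magnitude of the partial
    sums over an epoch matters. *)
Lemma enorm_sum_ord_le n (P : pred 'I_n) (u : 'I_n -> 'rV[R]_d) (c : R) :
  0 <= c -> (forall i, P i -> enorm (u i) <= c) ->
  enorm (\sum_(i < n | P i) u i) <= n%:R * c.
Proof.
move=> c0 uc; apply: le_trans (enorm_sum_le uc) _.
by rewrite ler_wpM2r // ler_nat (leq_trans (max_card _)) ?card_ord.
Qed.

End Euclidean.

(** A supremum of an unbounded set would be the default value 0, so the point
    is that the images of the unit ball are bounded, here by the sum of the norms
    of the rows of [A]; homogeneity then extends the bound to every [v]. *)
Lemma enorm_mulmx_le (R : realType) m n (A : 'M[R]_(m, n)) (v : 'rV[R]_m) :
  enorm (v *m A) <= specnorm A * enorm v.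
Proof.
have bnd (w : 'rV[R]_m) : enorm w <= 1 ->
    enorm (w *m A) <= \sum_(i < m) enorm (row i A).
  move=> w1; rewrite mulmx_sum_row (le_trans (enorm_sum _ _ _)) //.
  apply: ler_sum => i _; rewrite enormZ ler_piMl ?enorm_ge0 //.
  apply: le_trans w1; rewrite -sqrtr_sqr /enorm ler_wsqrtr //.
  by rewrite (bigD1 i) //= lerDl sumr_ge0 // => j _; rewrite sqr_ge0.
have ub (w : 'rV[R]_m) : enorm w <= 1 -> enorm (w *m A) <= specnorm A.
  move=> w1; apply: ub_le_sup; last by exists w.
  by exists (\sum_(i < m) enorm (row i A)) => _ [u u1 <-]; exact: bnd.
have [/enorm_eq0 ->|v0] := eqVneq (enorm v) 0.
  by rewrite mul0mx !enorm0 mulr0.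
have vp : 0 < enorm v by rewrite lt0r v0 enorm_ge0.
have := ub ((enorm v)^-1 *: v).
rewrite -scalemxAl !enormZ ger0_norm ?invr_ge0 ?enorm_ge0 // mulVf // lexx.
by rewrite mulrC ler_pdivrMr // => /(_ isT).
Qed.

(** * Calculus along a line *)

Section Calculus.
Context {R : realType} {d : nat}.
Implicit Types (f g : 'rV[R]_d -> R) (u v w x y : 'rV[R]_d).

Lemma is_derive_line (g : 'rV[R]_d -> R) x v (t : R) :
  derivable g (x + t *: v) v ->
  is_derive t 1 (fun s : R => g (x + s *: v)) ('D_v g (x + t *: v)).
Proof.
move=> dg.
have E : (fun h : R => h^-1 *: (g (x + (h *: 1 + t) *: v) - g (x + t *: v)))
    = (fun h : R => h^-1 *: (g (h *: v + (x + t *: v)) - g (x + t *: v))).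
  by apply/funext => h; rewrite [h *: 1]mulr1 scalerDl addrCA.
by apply: DeriveDef; rewrite /derivable /derive /= E.
Qed.

Lemma mean_value01 (phi dphi : R -> R) :
  (forall t : R, is_derive t 1 phi (dphi t)) ->
  exists2 c : R, 0 <= c <= 1 & phi 1 - phi 0 = dphi c.
Proof.
move=> dphiP; have [|c] := MVT_segment ler01 (fun t _ => dphiP t).
  by apply: derivable_within_continuous => t _; exact: ex_derive.
by rewrite in_itv /= subr0 mulr1 => c01 ->; exists c.
Qed.

Lemma mean_value_line g x v : (forall y, derivable g y v) ->
  exists2 c : R, 0 <= c <= 1 & g (x + v) - g x = 'D_v g (x + c *: v).
Proof.
move=> dg.
have [c c01] := mean_value01 (fun t => is_derive_line (dg (x + t *: v))).
by rewrite scale1r scale0r addr0 => ->; exists c.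
Qed.

Lemma derive_grad g x v : differentiable g x -> 'D_v g x = dot (grad g x) v.
Proof.
move=> dg; rewrite deriveE // {1}(row_sum_delta v) linear_sum.
by apply: eq_bigr => j _; rewrite linearZ /= mxE deriveE // mulrC.
Qed.

(** Pairing the gradient with a fixed vector [u] turns vector-valued statements
    into scalar ones, to which the mean value theorem applies. *)
Lemma is_derive_dot (g : 'rV[R]_d -> 'rV[R]_d) x v u : differentiable g x ->
  is_derive x v (fun y => dot (g y) u) (dot ('D_v g x) u).
Proof.
move=> dg.
have dgv := diff_derivable (v := v) dg.
have E : (fun y => dot (g y) u) =
    \sum_(j < d) (u 0 j *: (fun y => g y 0 j)).
  by apply/funext => y; rewrite fct_sumE; apply: eq_bigr => j _; rewrite mulrC.
rewrite E (_ : dot _ u = \sum_(j < d) (u 0 j *: 'D_v (fun y => g y 0 j) x)).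
  apply: is_derive_sum => j; apply: is_deriveZ; apply: derivableP.
  by move/derivable_mxP: dgv; apply.
by apply: eq_bigr => j _; rewrite derive_mx // mxE mulrC.
Qed.

Lemma derivable_dot_grad g u v y : differentiable (grad g) y ->
  derivable (fun y => dot (grad g y) u) y v.
Proof. by move=> dg; have := is_derive_dot v u dg => /@ex_derive. Qed.

Lemma mean_value_grad g x v u : twice_differentiable g ->
  exists2 c : R, 0 <= c <= 1 &
    dot (grad g (x + v) - grad g x) u = dot (v *m hess g (x + c *: v)) u.
Proof.
move=> [_ dg].
have [|c c01 E] := @mean_value_line (fun y => dot (grad g y) u) x v.
  by move=> y; exact: derivable_dot_grad.
exists c => //; rewrite dotBl E -deriveEjacobian //.
by have /@derive_val := is_derive_dot v u (dg (x + c *: v)).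
Qed.

(** The mean value theorem is applied to the difference between [g] on the segment
    and its quadratic upper model: the derivative of that difference is nonpositive
    by Lipschitz continuity of the gradient. The sharp constant [L / 2] is what lets
    [pl_smooth_constant] reach every [L < mu]. *)
Lemma descent_lemma (L : R) g x v : (forall y, differentiable g y) -> smooth L g ->
  g (x + v) <= g x + dot (grad g x) v + L / 2 * enorm v ^+ 2.
Proof.
move=> dg Lg; set b := dot (grad g x) v; set a := L / 2 * _.
have H (t : R) : is_derive t 1
   (fun s : R => g (x + s *: v) - (s * b + s ^+ 2 * a))
   ('D_v g (x + t *: v) - (b + 2 * t * a)).
  have H1 := is_derive_line (diff_derivable (v := v) (dg (x + t *: v))).
  have H2 : is_derive t 1 (fun s : R => s * b + s ^+ 2 * a) (b + 2 * t * a).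
    apply: is_derive_eq.
    rewrite /GRing.scale /= /cst /=; ring.
  exact: is_deriveB.
have [c /andP[c0 c1]] := mean_value01 H.
rewrite scale1r scale0r addr0 derive_grad // => E.
have : dot (grad g (x + c *: v) - grad g x) v <= 2 * c * a.
  apply: le_trans (dot_le _ _) _.
  have := ler_wpM2r (enorm_ge0 v) (Lg (x + c *: v) x).
  rewrite [x + _]addrC addrK enormZ (ger0_norm c0) => /le_trans; apply.
  by rewrite /a le_eqVlt; apply/orP; left; apply/eqP; field.
by rewrite dotBl -/b; lra.
Qed.

(** The left side is a limit of difference quotients of [y |-> dot (grad g y) u],
    each of which the Lipschitz bound on the gradient controls. *)
Lemma hess_dot_le (L : R) g x v u : twice_differentiable g -> smooth L g ->
  dot (v *m hess g x) u <= L * enorm v * enorm u.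
Proof.
move=> [_ dg] Lg; rewrite -deriveEjacobian //.
have /@derive_val <- := is_derive_dot v u (dg x).
have dv : derivable (fun y => dot (grad g y) u) x v by exact: derivable_dot_grad.
apply: limr_le => //.
near=> h.
have h0 : h != 0 by near: h; exact: nbhs_dnbhs_neq.
apply: le_trans (ler_norm _) _; rewrite normrZ -dotBl.
rewrite normfV ler_pdivrMl ?normr_gt0 //.
apply: le_trans (norm_dot_le _ _) _.
rewrite mulrA ler_wpM2r ?enorm_ge0 //.
apply: le_trans (Lg _ _) _; rewrite addrK enormZ.
by rewrite le_eqVlt; apply/orP; left; apply/eqP; ring.
Unshelve. all: by end_near. Qed.

(** The remainder is the difference of the Hessians at [x] and at a point of the
    segment. *)
Lemma grad_taylor (LH : R) g x v u : twice_differentiable g ->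
  lipschitz_hessian LH g ->
  `|dot (grad g (x + v) - grad g x) u - dot (v *m hess g x) u|
    <= `|LH| * enorm v ^+ 2 * enorm u.
Proof.
move=> dg Hg; have [c /andP[c0 c1] ->] := mean_value_grad x v u dg.
rewrite -dotBl -mulmxBr; apply: le_trans (norm_dot_le _ _) _.
rewrite ler_wpM2r ?enorm_ge0 //; apply: le_trans (enorm_mulmx_le _ _) _.
rewrite expr2 mulrA ler_wpM2r ?enorm_ge0 //; apply: le_trans (Hg _ _) _.
rewrite [x + _]addrC addrK enormZ (ger0_norm c0).
apply: (@le_trans _ _ (`|LH| * (c * enorm v))).
  by rewrite ler_wpM2r ?ler_norm // mulr_ge0 ?enorm_ge0.
by rewrite ler_wpM2l // ler_piMl ?enorm_ge0.
Qed.

End Calculus.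

(** * The average of the components *)

Section Average.
Context {R : realType} {d n : nat} (f : 'I_n -> 'rV[R]_d -> R).
Hypothesis df : forall i x, differentiable (f i) x.

Lemma averageE : average f = n%:R^-1 *: \sum_(i < n) f i.
Proof. by apply/funext => x; rewrite /average fctE /= fct_sumE. Qed.

Lemma differentiable_average x : differentiable (average f) x.
Proof. by rewrite averageE; apply/differentiableZ/differentiable_sum. Qed.

Lemma grad_average x : grad (average f) x = n%:R^-1 *: \sum_(i < n) grad (f i) x.
Proof.
apply/rowP => j; rewrite !mxE averageE deriveZ; last first.
  by apply: derivable_sum => i; exact: diff_derivable.
rewrite derive_sum; last by move=> i; exact: diff_derivable.
by congr (_ *: _); rewrite summxE; apply: eq_bigr => i _; rewrite mxE.
Qed.

Lemma sum_grad x : (0 < n)%N ->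
  \sum_(i < n) grad (f i) x = n%:R *: grad (average f) x.
Proof.
by move=> n0; rewrite grad_average scalerA divff ?scale1r // pnatr_eq0 -lt0n.
Qed.

Lemma grad_average_le x (G : R) : (0 < n)%N ->
  (forall i, enorm (grad (f i) x) <= G) -> enorm (grad (average f) x) <= G.
Proof.
move=> n0 fG; have n0' : 0 < n%:R :> R by rewrite ltr0n.
rewrite -(ler_pM2l n0') -{1}(ger0_norm (ltW n0')) -enormZ -sum_grad //.
by rewrite (le_trans (enorm_sum_le (c := G) _)) ?card_ord.
Qed.

Lemma smooth_average (L : R) : (0 < n)%N -> (forall i, smooth L (f i)) ->
  smooth L (average f).
Proof.
move=> n0 fL x y; have n0' : 0 < n%:R :> R by rewrite ltr0n.
rewrite -(ler_pM2l n0') -{1}(ger0_norm (ltW n0')) -enormZ scalerBr -!sum_grad //.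
rewrite -sumrB (le_trans (enorm_sum_le (c := L * enorm (x - y)) _)) ?card_ord //.
by move=> i _; exact: fL.
Qed.

End Average.

(** * Ordered pairs under a random permutation *)

(** Reading a permutation backwards exchanges the pairs [j < k] with the pairs
    [k < j] and preserves the uniform law. Hence the mean over the pairs [j < k] is
    half of the sum over all pairs of distinct indices, which no longer depends on
    the permutation. *)
Lemma sum_perm_ordered_pairs (R : realType) n (M : 'I_n -> 'I_n -> R) :
  (\sum_(s : 'S_n) \sum_(k < n) \sum_(j < n | (j < k)%N) M (s j) (s k)) * 2
  = #|{: 'S_n}|%:R * (\sum_(k < n) \sum_(j < n) M j k - \sum_(k < n) M k k).
Proof.
set A := \sum_s _.
have A' : A = \sum_(s : 'S_n) \sum_(k < n) \sum_(j < n | (k < j)%N) M (s j) (s k).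
  rewrite /A (reindex_inj (mulgI (perm (@rev_ord_inj n)))) /=.
  apply: eq_bigr => s _; rewrite (reindex_inj rev_ord_inj) /=.
  apply: eq_bigr => k _; rewrite (reindex_inj rev_ord_inj) /=.
  apply: eq_big => [j|j _]; last by rewrite !permM !permE !rev_ordK.
  by rewrite /=; have := ltn_ord j; have := ltn_ord k; lia.
rewrite mulr_natr mulr2n {1}A' -big_split /=.
rewrite mulr_natl -sumr_const; apply: eq_bigr => s _.
have -> : \sum_(k < n) \sum_(j < n) M j k
    = \sum_(k < n) \sum_(j < n) M (s j) (s k).
  rewrite (reindex_inj (@perm_inj _ s)) /=; apply: eq_bigr => k _.
  by rewrite (reindex_inj (@perm_inj _ s)).
have -> : \sum_(k < n) M k k = \sum_(k < n) M (s k) (s k).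
  by rewrite (reindex_inj (@perm_inj _ s)).
rewrite -sumrB -big_split; apply: eq_bigr => k _ /=.
rewrite [in RHS](bigID (fun j : 'I_n => (j < k)%N)) /=.
rewrite [X in _ = _ + X - _](bigD1 k) ?ltnn //=.
rewrite [X in _ = _ + (_ + X) - _](eq_bigl (fun j : 'I_n => (k < j)%N)).
  by ring.
by move=> j; rewrite -leqNgt ltn_neqAle andbC eq_sym.
Qed.

(** * The iterates of one epoch *)

Section EpochIter.
Context {R : realType} {d n : nat} (f : 'I_n -> 'rV[R]_d -> R) (gamma : R).
Variables (s : 'S_n) (x : 'rV[R]_d).
Local Notation X := (epoch_iter f gamma s x).

Lemma epoch_iter0 : X 0 = x.
Proof. by rewrite /epoch_iter take0. Qed.

Lemma epoch_iterS (k : 'I_n) : X k.+1 = X k - gamma *: grad (f (s k)) (X k).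
Proof.
by rewrite /epoch_iter (take_nth k) ?size_enum_ord // foldl_rcons nth_ord_enum.
Qed.

Lemma epoch_iterE k : (k <= n)%N ->
  X k = x - gamma *: \sum_(j < n | (j < k)%N) grad (f (s j)) (X j).
Proof.
elim: k => [|k IH] kn; first by rewrite big_pred0 // scaler0 subr0 epoch_iter0.
have := epoch_iterS (Ordinal kn) => /= ->; rewrite {1}IH ?(ltnW kn) //.
rewrite -addrA -opprD -scalerDr; congr (_ - _ *: _).
rewrite [in RHS](bigD1 (Ordinal kn)) ?ltnS //= addrC; congr (_ + _).
by apply: eq_bigl => j; rewrite ltnS ltn_neqAle andbC.
Qed.

End EpochIter.

(** * The mean decrease over one epoch *)

Section Epoch.
Context {R : realType} {d n : nat} (f : 'I_n -> 'rV[R]_d -> R).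
Variables (gamma L LH G : R).
Hypotheses (n0 : (0 < n)%N) (gamma0 : 0 <= gamma) (L0 : 0 <= L) (G0 : 0 <= G).
Hypothesis d2f : forall i, twice_differentiable (f i).
Hypothesis fL : forall i, smooth L (f i).
Hypothesis fH : forall i, lipschitz_hessian LH (f i).
Local Notation N := (gamma * n%:R).
(* Each gradient evaluated inside an epoch differs from the first-order model at
   the start of the epoch by at most [K * N ^+ 2]: the term in [LH] is the Taylor
   remainder, the other one the drift of the earlier gradients. *)
Local Notation K := (`|LH| * G ^+ 2 + L ^+ 2 * G).
Local Notation F := (average f).

Let N0 : 0 <= N. Proof. by rewrite mulr_ge0. Qed.

Let dF y : differentiable F y.
Proof. by apply: differentiable_average => i z; case: (d2f i). Qed.

Let sumg y : \sum_(i < n) grad (f i) y = n%:R *: grad F y.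
Proof. by apply: sum_grad => // i z; case: (d2f i). Qed.

(** The second-order effect of the step along component [j] on the later step
    along component [k], seen in the direction of the full gradient. *)
Definition interaction x (j k : 'I_n) : R :=
  dot (grad (f j) x *m hess (f k) x) (grad F x).

Section OneRun.
Variables (s : 'S_n) (x : 'rV[R]_d).
Local Notation X := (epoch_iter f gamma s x).
Local Notation a := (enorm (grad F x)).
Hypothesis XG : forall k : 'I_n, enorm (grad (f (s k)) (X k)) <= G.

Let a0 : 0 <= a. Proof. exact: enorm_ge0. Qed.

Let delta (k : 'I_n) := grad (f (s k)) (X k) - grad (f (s k)) x.

Let drift k : (k <= n)%N -> enorm (X k - x) <= N * G.
Proof.
move=> kn; rewrite epoch_iterE // addrC addKr enormN enormZ ger0_norm //.
by rewrite -mulrA ler_wpM2l // enorm_sum_ord_le.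
Qed.

Let delta_le k : enorm (delta k) <= L * (N * G).
Proof.
by apply: le_trans (fL _ _ _) _; rewrite ler_wpM2l // drift // ltnW.
Qed.

(* The displacement before step [k] is inserted into the Taylor expansion and its
   gradients are replaced by their values at [x]; both replacements cost a term
   of order [N ^+ 2]. *)
Let delta_dot (k : 'I_n) :
  - dot (delta k) (grad F x)
  <= gamma * (\sum_(j < n | (j < k)%N) interaction x (s j) (s k))
     + N ^+ 2 * K * a.
Proof.
have := grad_taylor x (X k - x) (grad F x) (d2f (s k)) (fH (s k)).
rewrite [x + _]addrC subrK -/(delta k) => T1.
have {T1} T1 : - dot (delta k) (grad F x)
    <= - dot ((X k - x) *m hess (f (s k)) x) (grad F x)
       + `|LH| * (N * G) ^+ 2 * a.
  have : `|LH| * enorm (X k - x) ^+ 2 * a <= `|LH| * (N * G) ^+ 2 * a.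
    rewrite ler_wpM2r // ler_wpM2l // ler_pXn2r ?nnegrE ?enorm_ge0 ?mulr_ge0 //.
    by rewrite drift // ltnW.
  by move: T1; rewrite ler_norml => /andP[]; lra.
apply: le_trans T1 _.
set e := \sum_(j < n | (j < k)%N) delta j.
have -> : X k - x =
    - (gamma *: (\sum_(j < n | (j < k)%N) grad (f (s j)) x + e)).
  rewrite epoch_iterE ?(ltnW (ltn_ord k)) // addrC addKr /e -big_split /=.
  by congr (- (_ *: _)); apply: eq_bigr => j _; rewrite addrC subrK.
rewrite mulNmx -scalemxAl mulmxDl dotNl dotZl dotDl mulmx_suml dot_suml opprK.
have T2 : dot (e *m hess (f (s k)) x) (grad F x) <= L * (n%:R * (L * (N * G))) * a.
  apply: le_trans (hess_dot_le _ _ _ (d2f _) (fL (s k))) _.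
  rewrite ler_wpM2r // ler_wpM2l //.
  by apply: enorm_sum_ord_le => [|j _]; rewrite ?delta_le // !mulr_ge0.
have := ler_wpM2l gamma0 T2; rewrite /interaction; lra.
Qed.

(** The whole epoch is one gradient step of length [N], minus [gamma] times the sum
    of the [delta k]. In the linear term of the descent lemma that sum is expanded
    to second order; in the quadratic term the crude bound [L * N * G] on each
    [delta k] suffices, since it enters squared. *)
Lemma epoch_descent :
  F (X n) <= F x - N * a ^+ 2
    + gamma ^+ 2 * (\sum_(k < n) \sum_(j < n | (j < k)%N) interaction x (s j) (s k))
    + N ^+ 3 * K * a + L * N ^+ 2 * a ^+ 2 + L ^+ 3 * N ^+ 4 * G ^+ 2.
Proof.
set S := \sum_(k < n) _; set e := \sum_(k < n) delta k.
have Xn : X n - x = - (gamma *: (n%:R *: grad F x + e)).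
  rewrite epoch_iterE // addrC addKr -sumg.
  rewrite [in RHS](reindex_inj (@perm_inj _ s)) /=.
  rewrite -big_split /=; congr (- (_ *: _)).
  by apply: eq_big => [j|j _]; rewrite ?ltn_ord // addrC subrK.
have en : enorm (X n - x) <= N * a + N * (L * (N * G)).
  rewrite Xn enormN enormZ ger0_norm // -mulrDr -mulrA ler_wpM2l //.
  rewrite mulrDr (le_trans (enormD _ _)) // lerD //.
    by rewrite enormZ ger0_norm.
  by apply: enorm_sum_ord_le => [|k _]; rewrite ?delta_le // !mulr_ge0.
have en2 : enorm (X n - x) ^+ 2 <= 2 * (N * a) ^+ 2 + 2 * (N * (L * (N * G))) ^+ 2.
  apply: (@le_trans _ _ ((N * a + N * (L * (N * G))) ^+ 2)).
    by rewrite ler_pXn2r ?nnegrE ?enorm_ge0 // addr_ge0 ?mulr_ge0.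
  have := sqr_ge0 (N * a - N * (L * (N * G))); lra.
have lin : dot (grad F x) (X n - x)
    <= - (N * a ^+ 2) + gamma ^+ 2 * S + N ^+ 3 * K * a.
  rewrite Xn dotNr dotZr dotDr dotZr -enorm_sqr dotC.
  have : - dot e (grad F x) <= gamma * S + n%:R * (N ^+ 2 * K * a).
    rewrite dot_suml -sumrN mulr_sumr mulr_natl -[X in _ *+ X]card_ord.
    rewrite -sumr_const -big_split; apply: ler_sum => k _; exact: delta_dot.
  by move=> /(ler_wpM2l gamma0); lra.
have := descent_lemma x (X n - x) dF (smooth_average (fun i => (d2f i).1) n0 fL).
rewrite [x + _]addrC subrK.
have L2 : 0 <= L / 2 by rewrite divr_ge0.
have := ler_wpM2l L2 en2; lra.
Qed.

End OneRun.

Variables (mu Fstar : R) (x : 'rV[R]_d).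
Hypothesis NL : L * N <= 8^-1.
Hypothesis PL : polyak_lojasiewicz mu F Fstar.
Hypothesis runG : forall (s : 'S_n) (k : 'I_n),
  enorm (grad (f (s k)) (epoch_iter f gamma s x k)) <= G.
Hypothesis xG : forall i, enorm (grad (f i) x) <= G.

(** Summing over [j] first reassembles the full gradient, so the double sum is
    quadratic in it; only the diagonal, with [n] times fewer terms, is linear. This
    gain is where random shuffling beats an arbitrary order. *)
Lemma sum_interaction_le :
  \sum_(k < n) \sum_(j < n) interaction x j k - \sum_(k < n) interaction x k k
  <= n%:R ^+ 2 * L * enorm (grad F x) ^+ 2 + n%:R * L * G * enorm (grad F x).
Proof.
set a := enorm _.
have sumc (c : R) : \sum_(k < n) c = n%:R * c.
  by rewrite sumr_const card_ord mulr_natl.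
apply: lerD.
  have -> : n%:R ^+ 2 * L * a ^+ 2 = \sum_(k < n) (n%:R * (L * a * a)).
    by rewrite sumc; ring.
  apply: ler_sum => k _; rewrite /interaction -dot_suml -mulmx_suml sumg.
  by rewrite -scalemxAl dotZl ler_wpM2l // hess_dot_le.
have -> : n%:R * L * G * a = \sum_(k < n) (L * G * a) by rewrite sumc; ring.
rewrite -sumrN; apply: ler_sum => k _; rewrite /interaction -dotNl -mulNmx.
apply: le_trans (hess_dot_le _ _ _ (d2f k) (fL k)) _.
by rewrite enormN ler_wpM2r ?enorm_ge0 // ler_wpM2l.
Qed.

(** Half of the decrease [N * enorm (grad F x) ^+ 2] absorbs all error terms that
    contain the gradient, those linear in it after completing a square; the other
    half becomes the contraction factor by the Polyak-Lojasiewicz inequality. *)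
Lemma epoch_contraction :
  (\sum_(s : 'S_n) F (epoch_iter f gamma s x n)) / #|{: 'S_n}|%:R - Fstar
  <= (1 - N * mu) * (F x - Fstar)
     + N * (gamma ^+ 2 * L ^+ 2 * G ^+ 2 + 4 * N ^+ 4 * K ^+ 2
            + L ^+ 3 * N ^+ 3 * G ^+ 2).
Proof.
set a := enorm (grad F x); have a0 : 0 <= a by exact: enorm_ge0.
have p0 : 0 < #|{: 'S_n}|%:R :> R by rewrite ltr0n; apply/card_gt0P; exists 1%g.
set p := #|{: 'S_n}|%:R in p0 *.
set Q := \sum_(k < n) \sum_(j < n) interaction x j k
         - \sum_(k < n) interaction x k k.
have Qle : Q <= n%:R ^+ 2 * L * a ^+ 2 + n%:R * L * G * a.
  exact: sum_interaction_le.
have sumc (c : R) : \sum_(s : 'S_n) c = p * c by rewrite sumr_const mulr_natl.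
have mean : (\sum_(s : 'S_n) F (epoch_iter f gamma s x n)) / p
    <= (F x - N * a ^+ 2 + N ^+ 3 * K * a + L * N ^+ 2 * a ^+ 2
        + L ^+ 3 * N ^+ 4 * G ^+ 2) + gamma ^+ 2 * (Q / 2).
  set B := (X in X + _).
  pose S (s : 'S_n) :=
    \sum_(k < n) \sum_(j < n | (j < k)%N) interaction x (s j) (s k).
  have run s : F (epoch_iter f gamma s x n) <= B + gamma ^+ 2 * S s.
    by have := epoch_descent (runG s); rewrite /B /S -/a; lra.
  have SE : \sum_(s : 'S_n) S s = p * (Q / 2).
    have := sum_perm_ordered_pairs (interaction x); rewrite -/p -/Q => SE.
    by rewrite mulrA -SE mulfK.
  rewrite ler_pdivrMr // (le_trans (ler_sum _ (fun s _ => run s))) //.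
  rewrite big_split /= sumc -mulr_sumr SE.
  by rewrite le_eqVlt; apply/orP; left; apply/eqP; ring.
(* [h3] and [h4] complete the squares of the two terms linear in [a]. *)
have h1 := ler_wpM2l N0 (ler_wpM2r (sqr_ge0 a) NL).
have h2 := ler_wpM2l (sqr_ge0 gamma) Qle.
have h3 := mulr_ge0 N0 (sqr_ge0 (a / 4 - gamma * L * G)).
have h4 := mulr_ge0 N0 (sqr_ge0 (a / 4 - 2 * N ^+ 2 * K)).
have h5 := ler_wpM2l N0 (PL x); rewrite -/a in h5.
have h6 := mulr_ge0 N0 (sqr_ge0 a).
move: h1 h2 h3 h4 h5 h6 mean; set k := K; lra.
Qed.

End Epoch.

(** * Independence of the epochs *)

Section Resampling.
Context {R : realType} {d n l : nat}.
Implicit Types (sigma : {ffun 'I_l -> 'S_n}) (t : 'I_l) (s : 'S_n).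

Definition resample sigma t s : {ffun 'I_l -> 'S_n} :=
  [ffun u => if u == t then s else sigma u].

(** For a fixed [s], replacing [sigma t] by [s * sigma t] permutes the families of
    permutations, and for a fixed [sigma] the product [s * sigma t] runs through all
    permutations. *)
Lemma sum_resample t (h : {ffun 'I_l -> 'S_n} -> R) :
  \sum_sigma \sum_(s : 'S_n) h (resample sigma t s)
  = #|{: 'S_n}|%:R * \sum_sigma h sigma.
Proof.
under eq_bigr => sigma _ do rewrite (reindex_inj (mulIg (sigma t))) /=.
rewrite exchange_big /= mulr_natl -sumr_const; apply: eq_bigr => s _.
rewrite [RHS](reindex_inj (h := fun sigma => resample sigma t (s * sigma t)%g)) //.
move=> sigma tau /ffunP E; apply/ffunP => u; have := E u; rewrite !ffunE.
by case: eqP => // -> /mulgI.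
Qed.

Variables (f : 'I_n -> 'rV[R]_d -> R) (gamma : R) (x0 : 'rV[R]_d).
Local Notation start := (epoch_start f gamma).

Lemma epoch_start0 sigma : start sigma x0 0 = x0.
Proof. by rewrite /epoch_start take0. Qed.

Lemma epoch_startS sigma t :
  start sigma x0 t.+1 = epoch_iter f gamma (sigma t) (start sigma x0 t) n.
Proof.
by rewrite /epoch_start (take_nth t) ?size_enum_ord // foldl_rcons nth_ord_enum.
Qed.

Lemma epoch_start_resample sigma t s :
  start (resample sigma t s) x0 t = start sigma x0 t.
Proof.
suff H k : (k <= t)%N -> start (resample sigma t s) x0 k = start sigma x0 k.
  exact: H.
elim: k => [|k IH] kt; first by rewrite !epoch_start0.
have kl : (k < l)%N := ltn_trans kt (ltn_ord t).
have E tau : start tau x0 k.+1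
    = epoch_iter f gamma (tau (Ordinal kl)) (start tau x0 k) n.
  exact: (epoch_startS tau (Ordinal kl)).
have Es : resample sigma t s (Ordinal kl) = sigma (Ordinal kl).
  by rewrite ffunE -val_eqE /= ltn_eqF.
apply: etrans (E _) _; rewrite Es (IH (ltnW kt)).
exact: esym (E sigma).
Qed.

(** This plays the part of conditioning on the other epochs. *)
Lemma shuffle_expectation_resample t (h : {ffun 'I_l -> 'S_n} -> R) :
  shuffle_expectation h = shuffle_expectation (fun sigma =>
    (\sum_(s : 'S_n) h (resample sigma t s)) / #|{: 'S_n}|%:R).
Proof.
rewrite /shuffle_expectation -mulr_suml sum_resample
  [X in _ = X / _]mulrAC mulfV ?mul1r //.
by rewrite pnatr_eq0 -lt0n; apply/card_gt0P; exists 1%g.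
Qed.

Lemma ler_expectation (g h : {ffun 'I_l -> 'S_n} -> R) :
  (forall sigma, g sigma <= h sigma) ->
  shuffle_expectation g <= shuffle_expectation h.
Proof. by move=> gh; rewrite ler_wpM2r ?invr_ge0 // ler_sum. Qed.

Lemma expectation_affine (b c : R) (g : {ffun 'I_l -> 'S_n} -> R) :
  shuffle_expectation (fun sigma => b * g sigma + c)
  = b * shuffle_expectation g + c.
Proof.
rewrite /shuffle_expectation big_split /= sumr_const -mulr_sumr -[c *+ _]mulr_natl.
rewrite mulrDl -mulrA; congr (_ + _); rewrite mulrAC mulfV ?mul1r //.
by rewrite pnatr_eq0 -lt0n; apply/card_gt0P; exists [ffun=> 1%g].
Qed.

End Resampling.

(** * The whole run *)

(** A gradient step of length [mu^-1] would decrease [F] by more than the gap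
    that the Polyak-Lojasiewicz inequality allows, unless the gradient vanishes. *)
Lemma pl_smooth_constant (R : realType) d (F : 'rV[R]_d -> R) (L mu Fstar : R) :
  0 < mu -> L < mu -> (forall x, differentiable F x) -> smooth L F ->
  polyak_lojasiewicz mu F Fstar -> (forall x, Fstar <= F x) ->
  forall x, F x = Fstar.
Proof.
move=> mu0 Lmu dF FL PL Fge x; apply/eqP; rewrite eq_le Fge andbT.
have := descent_lemma x (- mu^-1 *: grad F x) dF FL.
have := Fge (x + - mu^-1 *: grad F x).
rewrite dotZr -enorm_sqr enormZ normrN ger0_norm ?invr_ge0 ?(ltW mu0) //.
have := PL x; set A := enorm _; move=> h1 h2 h3.
have {h2 h3} h : Fstar <= F x - A ^+ 2 / mu + L / 2 * (A / mu) ^+ 2.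
  by apply: le_trans h2 _; apply: le_trans h3 _; rewrite le_eqVlt;
     apply/orP; left; apply/eqP; ring.
have h4 : F x - Fstar <= A ^+ 2 / (2 * mu).
  by rewrite ler_pdivlMr ?mulr_gt0 //; lra.
have h5 : A ^+ 2 / mu - L / 2 * (A / mu) ^+ 2
   = A ^+ 2 / (2 * mu) + (mu - L) * (A ^+ 2 / (2 * mu ^+ 2)).
  by field; rewrite gt_eqF.
have h6 : (mu - L) * (A ^+ 2 / (2 * mu ^+ 2)) <= 0 by lra.
have A0 : A ^+ 2 / (2 * mu ^+ 2) <= 0.
  by move: h6; rewrite pmulr_rle0 // subr_gt0.
have : A ^+ 2 <= 0.
  by move: A0; rewrite pmulr_lle0 // invr_gt0 mulr_gt0 ?exprn_gt0.
move=> A2; have : mu * (F x - Fstar) <= 0 by lra.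
by rewrite pmulr_rle0 // subr_le0.
Qed.

Section Run.
Context {R : realType} {d n l : nat} (f : 'I_n -> 'rV[R]_d -> R).
Variables (gamma L LH G mu Fstar : R) (x0 : 'rV[R]_d).
Hypotheses (n0 : (0 < n)%N) (gamma0 : 0 <= gamma) (L0 : 0 <= L) (G0 : 0 <= G).
Hypothesis d2f : forall i, twice_differentiable (f i).
Hypothesis fL : forall i, smooth L (f i).
Hypothesis fH : forall i, lipschitz_hessian LH (f i).
Local Notation N := (gamma * n%:R).
Local Notation K := (`|LH| * G ^+ 2 + L ^+ 2 * G).
Local Notation F := (average f).
Hypotheses (mu0 : 0 < mu) (muL : mu <= L) (NL : L * N <= 8^-1).
Hypothesis PL : polyak_lojasiewicz mu F Fstar.
Hypothesis runG : forall (sigma : {ffun 'I_l -> 'S_n}) t k i, (k <= n)%N ->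
  enorm (grad (f i) (shuffle_iter f gamma sigma x0 t k)) <= G.

Local Notation B := (gamma ^+ 2 * L ^+ 2 * G ^+ 2 + 4 * N ^+ 4 * K ^+ 2
            + L ^+ 3 * N ^+ 3 * G ^+ 2).
Let gap k := shuffle_expectation (fun sigma : {ffun 'I_l -> 'S_n} =>
   F (epoch_start f gamma sigma x0 k) - Fstar).

Let gapS k : (k < l)%N -> gap k.+1 <= (1 - N * mu) * gap k + N * B.
Proof.
move=> kl; pose t := Ordinal kl.
rewrite /gap (shuffle_expectation_resample t) -expectation_affine.
apply: ler_expectation => sigma.
have p0 : 0 < #|{: 'S_n}|%:R :> R by rewrite ltr0n; apply/card_gt0P; exists 1%g.
set x := epoch_start f gamma sigma x0 k.
have E s : epoch_start f gamma (resample sigma t s) x0 k.+1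
    = epoch_iter f gamma s x n.
  by rewrite (epoch_startS _ _ _ _ t) epoch_start_resample ffunE eqxx.
under eq_bigr => s _ do rewrite E.
rewrite sumrB sumr_const mulrBl -[Fstar *+ _]mulr_natl mulrAC mulfV ?gt_eqF // mul1r.
apply: (epoch_contraction n0 gamma0 L0 G0 d2f fL fH NL PL) => [s j|i].
  have := runG (resample sigma t s) t (s j) (ltnW (ltn_ord j)).
  by rewrite /shuffle_iter epoch_start_resample ffunE eqxx.
by have := runG sigma t i (leq0n n); rewrite /shuffle_iter epoch_iter0.
Qed.

(** The per-epoch error [N * B] is summed against the geometric factor
    [1 - N * mu], hence [B / mu]; the initial gap is bounded by the gradient at [x0]
    through the Polyak-Lojasiewicz inequality. *)
Lemma expected_gap_le : (0 < l)%N ->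
  gap l <= (1 - N * mu) ^+ l * (G ^+ 2 / (2 * mu)) + B / mu.
Proof.
move=> l0.
have N0 : 0 <= N by rewrite mulr_ge0.
have K0 : 0 <= K by rewrite addr_ge0 // mulr_ge0 // sqr_ge0.
have B0 : 0 <= B by rewrite !addr_ge0 // !mulr_ge0 ?sqr_ge0 ?exprn_ge0.
have Nmu : 0 <= 1 - N * mu.
  by move: NL; have h := ler_wpM2l N0 muL; lra.
suff H k : (k <= l)%N ->
    gap k <= (1 - N * mu) ^+ k * (G ^+ 2 / (2 * mu)) + B / mu by exact: H.
elim: k => [_|k IH kl].
  rewrite expr0 mul1r; apply: (@le_trans _ _ (G ^+ 2 / (2 * mu))); last first.
    by rewrite lerDl divr_ge0 // ltW.
  rewrite (_ : gap 0 = F x0 - Fstar); last first.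
    rewrite /gap /shuffle_expectation; under eq_bigr => s _ do rewrite epoch_start0.
    rewrite sumr_const -[_ *+ _]mulr_natl mulrAC mulfV ?mul1r //.
    by rewrite pnatr_eq0 -lt0n; apply/card_gt0P; exists [ffun=> 1%g].
  have gG : enorm (grad F x0) <= G.
    apply: grad_average_le => // i; first by case: (d2f i).
    have := runG [ffun=> 1%g] (Ordinal l0) i (leq0n n).
    by rewrite /shuffle_iter epoch_iter0 epoch_start0.
  have := PL x0; rewrite ler_pdivlMr ?mulr_gt0 //.
  have : enorm (grad F x0) ^+ 2 <= G ^+ 2 by rewrite ler_pXn2r ?nnegrE ?enorm_ge0.
  lra.
apply: le_trans (gapS kl) _.
apply: le_trans (lerD (ler_wpM2l Nmu (IH (ltnW kl))) (lexx (N * B))) _.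
rewrite le_eqVlt; apply/orP; left; apply/eqP; rewrite (exprS (1 - N * mu) k).
by field; rewrite gt_eqF.
Qed.

End Run.

Theorem theorem5 (R : realType) (mu L LH D G : R)
    (mu_gt0 : 0 < mu) (D_gt0 : 0 < D) (G_gt0 : 0 < G) :
  exists C0 q : R,
    [/\ 0 < C0, 0 < q
      & forall (d n l : nat) (f : 'I_n -> 'rV[R]_d -> R) (Fstar : R)
               (x0 : 'rV[R]_d),
          let F := average f in
          let kappa := L / mu in
          let T := (l * n)%N in
          let gamma := 2 * ln T%:R / (T%:R * mu) in
          (0 < n)%N ->
          (0 < l)%N ->
          (2 <= T)%N ->
          (forall i, twice_differentiable (f i)) ->
          (forall i, smooth L (f i)) ->
          (forall i, lipschitz_hessian LH (f i)) ->
          is_min_value F Fstar ->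
          polyak_lojasiewicz mu F Fstar ->
          bounded_run l f gamma x0 D G ->
          16 * kappa ^+ 2 * n%:R < T%:R / ln T%:R ->
          shuffle_expectation
            (fun sigma : {ffun 'I_l -> 'S_n} =>
               F (shuffle_output f gamma sigma x0) - Fstar)
          <= C0 * (1 + ln T%:R) `^ q
             * (1 / T%:R ^+ 2 + n%:R ^+ 3 / T%:R ^+ 3)].
Proof.
(* For [L < mu] the objective is constant and any constants do. *)
have [Lmu|muL] := ltP L mu.
  exists 1, 1; split => // d n l f Fstar x0 F kappa T gamma n0 l0 T2 d2f fL fH.
  move=> [Fge _] PL _ _.
  have FE x : F x = Fstar.
    apply: (pl_smooth_constant mu_gt0 Lmu _ _ PL Fge).
      by move=> y; apply: differentiable_average => i z; case: (d2f i).
    by apply: smooth_average => // i z; case: (d2f i).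
  rewrite /shuffle_expectation big1 => [|sigma _]; last by rewrite FE subrr.
  by rewrite mul0r !mulr_ge0 ?powR_ge0 // addr_ge0 ?divr_ge0 ?exprn_ge0.
have L0 : 0 < L by exact: lt_le_trans mu_gt0 muL.
pose K := `|LH| * G ^+ 2 + L ^+ 2 * G.
(* [C1] collects the initial gap and the error in [gamma ^+ 2], and [C2] the errors
   in [N ^+ 3] and [N ^+ 4], where one factor [N] is bounded by [(8 * L)^-1]. *)
pose C1 := G ^+ 2 / (2 * mu) + 4 * L ^+ 2 * G ^+ 2 / mu ^+ 3.
pose C2 := 8 * (K ^+ 2 / (2 * L) + L ^+ 3 * G ^+ 2) / mu ^+ 4.
have C1gt0 : 0 < C1.
  by rewrite addr_gt0 ?divr_gt0 ?mulr_gt0 ?exprn_gt0.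
have C2ge0 : 0 <= C2.
  rewrite divr_ge0 ?mulr_ge0 ?addr_ge0 ?exprn_ge0 ?(ltW L0) ?(ltW mu_gt0) //.
    by rewrite divr_ge0 ?sqr_ge0 ?mulr_ge0 // ltW.
  by rewrite mulr_ge0 ?sqr_ge0 ?exprn_ge0 ?(ltW L0).
exists (C1 + C2), 3%:R; split => //; first by rewrite ltr_pwDl.
move=> d n l f Fstar x0 F kappa T gamma n0 l0 T2 d2f fL fH [Fge _] PL.
move=> [xstar [_ run runG]] hT.
have T0 : 0 < T%:R :> R by rewrite ltr0n; exact: leq_trans T2.
set lam := ln T%:R in gamma run hT *.
have lam0 : 0 < lam by rewrite ln_gt0 // ltr1n.
have n0' : 0 < n%:R :> R by rewrite ltr0n.
have gamma0 : 0 <= gamma by rewrite divr_ge0 ?mulr_ge0 ?ltW // mulr_gt0.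
set N := gamma * n%:R.
have N0 : 0 <= N by rewrite mulr_ge0.
have NE : N = 2 * lam * n%:R / (T%:R * mu) by rewrite /N /gamma mulrAC.
(* Here [1 <= kappa] replaces the factor [kappa ^+ 2] of the hypothesis by the
   single [kappa] that occurs in [L * N]. *)
have NL : L * N <= 8^-1.
  have k1 : 1 <= kappa by rewrite ler_pdivlMr // mul1r.
  have h1 : 16 * kappa ^+ 2 * n%:R * lam < T%:R by rewrite -ltr_pdivlMr.
  have h2 : kappa * (n%:R * lam) <= kappa ^+ 2 * (n%:R * lam).
    by rewrite ler_wpM2r ?mulr_ge0 ?(ltW lam0) // expr2 ler_peMl // (le_trans _ k1).
  have -> : L * N = 2 * (kappa * (n%:R * lam)) / T%:R.
    by rewrite NE /kappa; field; rewrite !gt_eqF.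
  rewrite ler_pdivrMr //; lra.
have rG (sigma : {ffun 'I_l -> 'S_n}) t k i : (k <= n)%N ->
    enorm (grad (f i) (shuffle_iter f gamma sigma x0 t k)) <= G.
  by move=> kn; apply: runG; exact: run.
apply: le_trans (expected_gap_le n0 gamma0 (ltW L0) (ltW G_gt0) d2f fL fH mu_gt0 muL
  NL PL rG l0) _.
rewrite -/N -/K powR_mulrn ?addr_ge0 ?(ltW lam0) //.
(* The factor 2 in the step size makes [expR (- (N * mu)) ^+ l] exactly
   [T%:R ^- 2]. *)
have contr : (1 - N * mu) ^+ l <= 1 / T%:R ^+ 2.
  have -> : 1 / T%:R ^+ 2 = expR (- (N * mu)) ^+ l.
    rewrite -expRM_natr NE.
    have -> : - (2 * lam * n%:R / (T%:R * mu) * mu) * l%:R = - (2 * lam).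
      rewrite /T natrM; field; rewrite !gt_eqF ?ltr0n //.
    by rewrite expRN expRM_natl lnK ?posrE // div1r.
  have Nmu : N * mu <= 8^-1.
    by apply: le_trans NL; rewrite mulrC ler_wpM2r.
  rewrite lerXn2r ?nnegrE ?expR_ge0 //; first lra.
  by have := expR_ge1Dx (- (N * mu)).
set W := (1 + lam) ^+ 3.
have W1 : 1 <= W by rewrite exprn_ege1 // lerDl ltW.
have W2 : lam ^+ 2 <= W.
  by rewrite /W; have := exprn_gt0 2 lam0; have := exprn_gt0 3 lam0; lra.
have W3 : lam ^+ 3 <= W.
  by rewrite /W; have := exprn_gt0 2 lam0; lra.
have N4 : N ^+ 4 <= N ^+ 3 / (8 * L).
  rewrite ler_pdivlMr ?mulr_gt0 //.
  by have := ler_wpM2l (exprn_ge0 3 N0) NL; lra.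
set A := 1 / T%:R ^+ 2 in contr *; set E := n%:R ^+ 3 / T%:R ^+ 3.
have A0 : 0 <= A by rewrite divr_ge0 ?exprn_ge0.
have E0 : 0 <= E by rewrite divr_ge0 ?exprn_ge0.
have gE : gamma ^+ 2 = 4 * lam ^+ 2 / mu ^+ 2 * A.
  by rewrite /gamma /A; field; rewrite !gt_eqF.
have N3E : N ^+ 3 = 8 * lam ^+ 3 / mu ^+ 3 * E.
  by rewrite NE /E; field; rewrite !gt_eqF.
have g2 : gamma ^+ 2 <= 4 / mu ^+ 2 * (W * A).
  rewrite gE [leRHS](_ : _ = 4 * W / mu ^+ 2 * A); last by ring.
  by rewrite ler_wpM2r // ler_wpM2r ?invr_ge0 ?exprn_ge0 ?(ltW mu_gt0) // ler_wpM2l.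
have N3 : N ^+ 3 <= 8 / mu ^+ 3 * (W * E).
  rewrite N3E [leRHS](_ : _ = 8 * W / mu ^+ 3 * E); last by ring.
  by rewrite ler_wpM2r // ler_wpM2r ?invr_ge0 ?exprn_ge0 ?(ltW mu_gt0) // ler_wpM2l.
apply: (@le_trans _ _ (W * A * C1 + W * E * C2)); last first.
  have := mulr_ge0 (mulr_ge0 (le_trans ler01 W1) A0) C2ge0.
  have := mulr_ge0 (mulr_ge0 (le_trans ler01 W1) E0) (ltW C1gt0); lra.
have c0 : 0 <= G ^+ 2 / (2 * mu) by rewrite divr_ge0 ?sqr_ge0 // mulr_ge0 // ltW.
have p1 : (1 - N * mu) ^+ l * (G ^+ 2 / (2 * mu)) <= W * A * (G ^+ 2 / (2 * mu)).
  by rewrite ler_wpM2r // (le_trans contr) // ler_peMl.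
have p2 : gamma ^+ 2 * (L ^+ 2 * G ^+ 2 / mu)
    <= 4 / mu ^+ 2 * (W * A) * (L ^+ 2 * G ^+ 2 / mu).
  by rewrite ler_wpM2r // divr_ge0 ?mulr_ge0 ?sqr_ge0 // ltW.
have p3 : N ^+ 4 * (4 * K ^+ 2 / mu) <= N ^+ 3 / (8 * L) * (4 * K ^+ 2 / mu).
  by rewrite ler_wpM2r // divr_ge0 ?(ltW mu_gt0) // mulr_ge0 // sqr_ge0.
have p4 : N ^+ 3 * ((K ^+ 2 / (2 * L) + L ^+ 3 * G ^+ 2) / mu)
   <= 8 / mu ^+ 3 * (W * E) * ((K ^+ 2 / (2 * L) + L ^+ 3 * G ^+ 2) / mu).
  rewrite ler_wpM2r // divr_ge0 ?(ltW mu_gt0) // addr_ge0 //.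
    by rewrite divr_ge0 ?sqr_ge0 ?mulr_ge0 // ltW.
  by rewrite mulr_ge0 ?sqr_ge0 ?exprn_ge0 ?(ltW L0).
have -> : W * A * C1 + W * E * C2 =
   W * A * (G ^+ 2 / (2 * mu)) + 4 / mu ^+ 2 * (W * A) * (L ^+ 2 * G ^+ 2 / mu)
   + 8 / mu ^+ 3 * (W * E) * ((K ^+ 2 / (2 * L) + L ^+ 3 * G ^+ 2) / mu).
  by rewrite /C1 /C2; field; rewrite !gt_eqF.
have p5 : (gamma ^+ 2 * L ^+ 2 * G ^+ 2 + 4 * N ^+ 4 * K ^+ 2
             + L ^+ 3 * N ^+ 3 * G ^+ 2) / mu
    <= gamma ^+ 2 * (L ^+ 2 * G ^+ 2 / mu)
       + N ^+ 3 * ((K ^+ 2 / (2 * L) + L ^+ 3 * G ^+ 2) / mu).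
  have -> : gamma ^+ 2 * (L ^+ 2 * G ^+ 2 / mu)
     + N ^+ 3 * ((K ^+ 2 / (2 * L) + L ^+ 3 * G ^+ 2) / mu)
     = (gamma ^+ 2 * L ^+ 2 * G ^+ 2 / mu + L ^+ 3 * N ^+ 3 * G ^+ 2 / mu)
       + N ^+ 3 / (8 * L) * (4 * K ^+ 2 / mu).
    by field; rewrite !gt_eqF.
  have -> : (gamma ^+ 2 * L ^+ 2 * G ^+ 2 + 4 * N ^+ 4 * K ^+ 2
             + L ^+ 3 * N ^+ 3 * G ^+ 2) / mu
     = (gamma ^+ 2 * L ^+ 2 * G ^+ 2 / mu + L ^+ 3 * N ^+ 3 * G ^+ 2 / mu)
       + N ^+ 4 * (4 * K ^+ 2 / mu) by ring.
  by rewrite lerD2l.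
by rewrite -[leRHS]addrA; apply: lerD p1 _; apply: le_trans p5 _; exact: lerD.
Qed.
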